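(* Let $s\ge1$ be an integer, let $a\in(0,1]$, let $(h_n)_{n\ge1}$ be positive reals with $h_n\to0$, and let $\{K_n\}_{n\ge1}$ be a sequence of kernels of order $s$ on $\mathbb{R}$ such that: (1) $\alpha_s(K_n)=O(h_n^a)$ as $n\to\infty$; (2) $\sup_n\beta_{s+a}(K_n)<\infty$. Let $f$ be a probability density on $\mathbb{R}$ with absolutely continuous derivative $f^{(s-1)}$ and with $f^{(s)}\in L_1(\mathbb{R})$, and assume that for some $0<c<\infty$, $$\omega(\delta):=\sup_{|t|\le\delta}\int\left|f^{(s)}(x-t)-f^{(s)}(x)\right|dx\le c\,|\delta|^a\quad\text{for all }\delta>0 .$$ Then $$\|f\ast S_{h_n}K_n-f\|_1=O(h_n^{s+a})\quad\text{as } n\to\infty .$$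
   Context: All integrals are over $\mathbb{R}$ with respect to Lebesgue measure, and $\|g\|_1=\int|g|$. A kernel is a (measurable, integrable, real-valued, not necessarily nonnegative) function $K$ on $\mathbb{R}$ with $\int K(x)\,dx=1$. For a function $K$, $\alpha_j(K)=\int t^jK(t)\,dt$ (integer $j\ge0$) and $\beta_m(K)=\int|t|^m|K(t)|\,dt$ (real $m\ge0$). A kernel $K$ is of order $s$ if $\alpha_j(K)=0$ for $j=1,\dots,s-1$ and $\alpha_s(K)\neq0$ (with these moments absolutely convergent). For $h>0$, $(S_hK)(x)=\frac1hK\left(\frac xh\right)$. Convolution is $(f\ast g)(x)=\int g(y)f(x-y)\,dy$. We write $f^{(0)}=f$. *)

(* Defs.v *)
From HB Require Import structures.
From mathcomp Require Import all_boot all_order all_algebra.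
From mathcomp Require Import all_classical all_reals all_analysis.

Set Implicit Arguments.
Unset Strict Implicit.
Unset Printing Implicit Defensive.

Import Order.TTheory GRing.Theory Num.Theory.
Import numFieldNormedType.Exports.

Local Open Scope classical_set_scope.
Local Open Scope ring_scope.

Section kernels.
Variable R : realType.
Local Notation mu := (@lebesgue_measure R).
Implicit Types (f g K : R -> R).

Definition L1 g : Prop := mu.-integrable setT (EFin \o g).

(* Extended-real valued, so that divergence is visible as +oo. *)
Definition norm1 g : \bar R := (\int[mu]_x `|g x|%:E)%E.

Definition is_density f : Prop :=
  [/\ (forall x, 0 <= f x), L1 f & \int[mu]_x f x = 1].

Definition is_kernel K : Prop := L1 K /\ \int[mu]_x K x = 1.

(* [\int] in R is total: it carries information only when
   t ^+ j * K t is integrable, which [kernel_of_order] requires up to j = s. *)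
Definition alpha (j : nat) K : R := \int[mu]_t (t ^+ j * K t).

Definition beta (m : R) K : \bar R := (\int[mu]_t (`|t| `^ m * `|K t|)%:E)%E.

Definition kernel_of_order (s : nat) K : Prop :=
  [/\ is_kernel K,
      (forall j, (1 <= j <= s)%N -> L1 (fun t => t ^+ j * K t)),
      (forall j, (1 <= j < s)%N -> alpha j K = 0)
    & alpha s K != 0].

Definition dilate (h : R) K : R -> R := fun x => h^-1 * K (x / h).

Definition convolution f g : R -> R := fun x => \int[mu]_y (g y * f (x - y)).

Definition abs_continuous_on (a b : R) f : Prop :=
  forall e : R, 0 < e -> exists2 d : R, 0 < d &
    forall (n : nat) (u v : 'I_n -> R),
      (forall i, [/\ a <= u i, u i <= v i & v i <= b]) ->
      trivIset setT (fun i => `]u i, v i[%classic) ->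
      \sum_(i < n) (v i - u i) < d ->
      \sum_(i < n) `|f (v i) - f (u i)| < e.

(* On the whole line, absolute continuity is meant on every compact
   interval. *)
Definition abs_continuous f : Prop := forall a b, abs_continuous_on a b f.

(* [derive1n k f] is a total function whose value is meaningless where the
   derivative does not exist; hence the explicit existence of the derivatives
   of order up to s - 1.  [derive1n s f] then exists almost everywhere,
   by absolute continuity of [derive1n s.-1 f]. *)
Definition abs_continuous_deriv (s : nat) f : Prop :=
  (forall k, (k < s.-1)%N -> forall x, derivable (derive1n k f) x 1) /\
  abs_continuous (derive1n s.-1 f).

Definition L1_modulus g (delta : R) : \bar R :=
  ereal_sup [set norm1 (fun x => g (x - t) - g x) | t in [set t | `|t| <= delta]].

End kernels.

(* Main.v *)
Require Import Defs.
From HB Require Import structures.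
From mathcomp Require Import all_boot all_order all_algebra.
From mathcomp Require Import all_classical all_reals all_analysis.
From mathcomp Require Import measurable_realfun ring lra.

Import Order.TTheory GRing.Theory Num.Theory.
Import numFieldNormedType.Exports.

Local Open Scope classical_set_scope.
Local Open Scope ring_scope.

(** Write [D k] for the [k]-th derivative of [f], put [g := D s], and expand
    [f (x - u)] at [x] up to order [s], with remainder [r x u].  Integrated in
    [u] against the dilated kernel, the zeroth term of the expansion gives
    [f x], the terms of order 1, ..., s - 1 vanish, and the term of order [s]
    gives [(-1)^s / s! * h^s * alpha_s * g x].  Hence the error at [x] is

      [(-1)^s / s! * h^s * alpha_s * g x + \int_u K_h u * r x u],

    and the assumption [alpha_s = O(h^a)] makes the [L^1] norm of the first
    summand [O(h^(s+a))].  For the second one it suffices to know that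
    [\int_x |r x u| <= c |u|^(s+a)] ([norm1_taylor_rem]): by Tonelli and a
    rescaling its norm is then at most [c h^(s+a) beta_(s+a)].

    The bound on the remainder is an induction on the order.  At order 0 the
    remainder of [g] is a translate of [g] minus [g], which is what the modulus
    of continuity controls.  The remainder of order [k + 1] of a primitive of
    [F] is [t] times the average over [th] in [[0, 1]] of the remainder of
    order [k] of [F] at [t * th] ([taylor_remS]), so Minkowski's integral
    inequality multiplies the bound by [|t|], without changing the constant.

    All of this needs [D k] to be the integral of [D k.+1].  For [k < s - 1]
    this is the fundamental theorem of calculus for [C^1] functions.  For
    [k = s - 1] it is the one of Lebesgue for absolutely continuous functions
    ([abs_continuous_primitive]), proved here as follows.  The total variation
    of an absolutely continuous [F] is absolutely continuous
    ([ac_along_tv_fun]), which makes [F] a difference of two nondecreasing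
    absolutely continuous functions.  The Stieltjes measure of each of them is
    dominated by the Lebesgue measure, hence has a density by the
    Radon-Nikodym theorem ([nondecreasing_ac_density]); so [F] is the integral
    of some integrable [phi], and [F' = phi] almost everywhere by Lebesgue's
    differentiation theorem. *)

(** * Absolute continuity and total variation *)

Section ac_lists.
Set Implicit Arguments.
Unset Strict Implicit.
Context {R : realType}.
Implicit Types (F G : R -> R) (l : seq (bool * R)).

(** A list [l] of pairs encodes a subdivision starting at [x] together with a
    flag telling which of its cells are counted.  Families of disjoint
    intervals become lists this way, which can be concatenated and refined by
    induction; for [G := id] the value is the total length of the counted
    cells. *)
Fixpoint flagged_variation G (x : R) l : R :=
  if l is (b, y) :: l' then
    (if b then `|G y - G x| else 0) + flagged_variation G y l'
  else 0.

Local Notation fv := flagged_variation.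

Definition ac_along (A B : R) G := forall e : R, 0 < e ->
  exists2 d : R, 0 < d & forall (x : R) l, A <= x ->
    path <=%R x (unzip2 l) -> last x (unzip2 l) <= B ->
    fv id x l < d -> fv G x l < e.

Lemma flagged_variation_ord G x l : fv G x l =
  \sum_(i < size l) (if nth false (unzip1 l) i then
    `|G (nth 0 (x :: unzip2 l) i.+1) - G (nth 0 (x :: unzip2 l) i)| else 0).
Proof.
elim: l x => [x|[b y] l IH x]; first by rewrite /= big_ord0.
by rewrite big_ord_recl /= IH.
Qed.

(** A cell that is not counted is sent to an empty interval, so that the
    intervals are indexed by all the cells of the subdivision. *)
Lemma abs_continuous_on_along A B F :
  abs_continuous_on A B F -> ac_along A B F.
Proof.
move=> acF e /acF[d d0 Hd]; exists d => // x l Ax xl lB ld.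
pose t i := nth 0 (x :: unzip2 l) i.
pose v i := if nth false (unzip1 l) i then t i.+1 else t i.
have szt : size (x :: unzip2 l) = (size l).+1 by rewrite /= size_map.
have tmono i j : (i <= j)%N -> (j <= size l)%N -> t i <= t j.
  move=> ij jl; apply: (sorted_leq_nth le_trans lexx) => //.
    by rewrite inE szt ltnS (leq_trans ij).
  by rewrite inE szt ltnS.
have vt i : (i < size l)%N -> v i <= t i.+1.
  by move=> il; rewrite /v; case: ifP => // _; exact: tmono.
have tv i : (i < size l)%N -> t i <= v i.
  by move=> il; rewrite /v; case: ifP => // _; exact: tmono.
have vE G : fv G x l = \sum_(i < size l) `|G (v i) - G (t i)|.
  rewrite flagged_variation_ord; apply: eq_bigr => i _; rewrite /v.
  by case: ifP => // _; rewrite subrr normr0.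
rewrite vE; apply: (Hd (size l) (fun i => t i) (fun i => v i)).
- move=> i; split; last 1 first.
  + apply: (le_trans (vt _ (ltn_ord i))); apply: le_trans lB.
    rewrite (last_nth 0) size_map; exact: tmono.
  + by apply: (le_trans Ax); apply: (tmono 0%N i) => //; exact: ltnW.
  + exact: tv.
- apply/trivIsetP => i j _ _.
  wlog ij : i j / (i < j)%N => [H|_].
    rewrite neq_ltn => /orP[|] ij; last rewrite setIC.
      by apply: H => //; rewrite neq_ltn ij.
    by apply: H => //; rewrite neq_ltn ij.
  rewrite -subset0 => z [] /=; rewrite !in_itv/= => /andP[_ zv] /andP[tz _].
  have := lt_trans tz zv; rewrite ltNge (le_trans (vt _ (ltn_ord _)))//.
  by apply: tmono => //; exact: ltnW.
- apply: le_lt_trans ld; rewrite vE; apply: ler_sum => i _.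
  exact: ler_norm.
Qed.

Lemma flagged_variation_cat G x l1 l2 :
  fv G x (l1 ++ l2) = fv G x l1 + fv G (last x (unzip2 l1)) l2.
Proof. by elim: l1 x => [x|[b y] l1 IH x] /=; rewrite ?add0r// IH addrA. Qed.

Lemma flagged_variation_variation G a b s :
  fv G a [seq (true, y) | y <- s] = variation a b G s.
Proof.
elim: s a => [a|y s IH a]; first by rewrite variation_nil.
by rewrite /= IH /variation /= big_nat_recl.
Qed.

Lemma flagged_variation_id x s : path <=%R x s ->
  fv id x [seq (true, y) | y <- s] = last x s - x.
Proof.
elim: s x => [x _|y s IH x /= /andP[xy ys]]; first by rewrite subrr.
have -> : `|id y - id x| = y - x by rewrite ger0_norm ?subr_ge0.
by rewrite IH// addrC subrKA.
Qed.

Lemma flagged_variation_iota G (t : nat -> R) (P : pred nat) m n :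
  fv G (t m) [seq (P i, t i.+1) | i <- iota m n] =
  \sum_(i <- iota m n | P i) `|G (t i.+1) - G (t i)|.
Proof.
elim: n m => [m|n IH m] /=; first by rewrite big_nil.
by rewrite IH big_cons; case: (P m); rewrite ?add0r.
Qed.

Lemma flagged_variationB F G x l :
  fv (F \- G) x l <= fv F x l + fv G x l.
Proof.
elim: l x => [x|[b y] l IH x] /=; first by rewrite addr0.
rewrite addrACA lerD//; case: b; last by rewrite addr0.
rewrite (_ : F y - G y - (F x - G x) = (F y - F x) - (G y - G x)); last by ring.
by rewrite (le_trans (ler_normB _ _)).
Qed.

Lemma ac_alongB A B F G :
  ac_along A B F -> ac_along A B G -> ac_along A B (F \- G).
Proof.
move=> acF acG e e0; have e20 : 0 < e / 2 by rewrite divr_gt0.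
have [d1 d10 H1] := acF _ e20; have [d2 d20 H2] := acG _ e20.
exists (Num.min d1 d2); first by rewrite lt_min d10.
move=> x l Ax xl lB; rewrite lt_min => /andP[ld1 ld2].
apply: (le_lt_trans (flagged_variationB _ _ _ _)).
by rewrite (splitr e) ltrD// ?H1// H2.
Qed.

Lemma path_lt_le (x : R) s : path <%R x s -> path <=%R x s.
Proof. by apply: sub_path => a b; exact: ltW. Qed.

(** With [d] associated to the variation 1, a segment shorter than [d] carries
    variation at most 1, and finitely many such segments cover [[A, B]]. *)
Lemma ac_along_bounded_variation A B F : A <= B ->
  ac_along A B F -> bounded_variation A B F.
Proof.
move=> AB /(_ 1 ltr01)[d d0 Hd]; apply/bounded_variationP => //.
have small x y : A <= x -> x <= y -> y <= B -> y - x < d ->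
    (total_variation x y F <= 1)%E.
  move=> Ax xy yB xyd; apply: ge_ereal_sup => _ [_ [s [xs /eqP sy] <-] <-].
  rewrite lee_fin -flagged_variation_variation ltW//; apply: Hd => //.
  - by rewrite /unzip2 -map_comp map_id; exact: path_lt_le.
  - by rewrite /unzip2 -map_comp map_id sy.
  - by rewrite flagged_variation_id ?sy//; exact: path_lt_le.
have H k x : A <= x -> x <= B -> B - x < k%:R * (d / 2) ->
    (total_variation x B F <= k%:R%:E)%E.
  elim: k x => [x Ax xB|k IH x Ax xB Bx].
    by rewrite mul0r subr_lt0 => /(le_lt_trans xB); rewrite ltxx.
  have [dB|Bd] := leP (x + d / 2) B; last first.
    apply: (@le_trans _ _ 1%E); last by rewrite lee_fin ler1n.
    apply: small => //; lra.
  rewrite (@total_variationD _ _ _ (x + d / 2))//; last lra.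
  rewrite -[k.+1%:R]natr1 [k%:R + 1]addrC EFinD leeD//.
    by apply: small => //; lra.
  apply: IH => //; first lra.
  by move: Bx; rewrite -[k.+1%:R]natr1 mulrDl mul1r; lra.
rewrite ge0_fin_numE ?total_variation_ge0//.
have BA0 : 0 <= (B - A) / (d / 2) by rewrite divr_ge0 ?subr_ge0//; lra.
apply: (@le_lt_trans _ _ (Num.bound ((B - A) / (d / 2)))%:R%:E); last exact: ltry.
apply: H => //; have := archi_boundP BA0.
by rewrite ltr_pdivrMr// divr_gt0.
Qed.

Definition tv_fun (A : R) F x : R := fine (total_variation A x F).

Section refinement.
Variables (A B : R) (F : R -> R).
Hypothesis bvF : bounded_variation A B F.

Lemma total_variation_sub_fin x y : A <= x -> x <= y -> y <= B ->
  total_variation x y F \is a fin_num.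
Proof.
move=> Ax xy yB; apply/bounded_variationP => //.
by apply: (bounded_variationl xy yB); apply: bounded_variationr bvF => //;
  exact: le_trans yB.
Qed.

Lemma tv_funB x y : A <= x -> x <= y -> y <= B ->
  (tv_fun A F y - tv_fun A F x)%:E = total_variation x y F.
Proof.
move=> Ax xy yB; have xB := le_trans xy yB.
rewrite /tv_fun (total_variationD F Ax xy) fineD ?total_variation_sub_fin//.
by rewrite addrC addKr fineK// total_variation_sub_fin.
Qed.

Lemma le_tv_fun x y : A <= x -> x <= y -> y <= B ->
  tv_fun A F x <= tv_fun A F y.
Proof.
move=> Ax xy yB; rewrite -subr_ge0 -lee_fin tv_funB//.
exact: total_variation_ge0.
Qed.

Lemma tv_fun_ge x y : A <= x -> x <= y -> y <= B ->
  `|F y - F x| <= tv_fun A F y - tv_fun A F x.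
Proof.
by move=> Ax xy yB; rewrite -lee_fin tv_funB//; exact: total_variation_ge.
Qed.

(** Each counted cell is cut so finely that the variation of [F] on it nearly
    reaches its supremum, which is the increment of [tv_fun A F].  The counted
    length is left unchanged, so absolute continuity of [F] applies to the
    refined list. *)
Lemma flagged_variation_refine l (x eta : R) : 0 < eta -> A <= x ->
  path <=%R x (unzip2 l) -> last x (unzip2 l) <= B ->
  exists l', [/\ path <=%R x (unzip2 l'),
    last x (unzip2 l') = last x (unzip2 l), fv id x l' = fv id x l &
    fv (tv_fun A F) x l <= fv F x l' + eta].
Proof.
elim: l x eta => [x eta eta0 _ _ _|[b y] l IH x eta eta0 Ax /= /andP[xy yl] lB].
  by exists [::]; rewrite /= add0r ltW.
have eta20 : 0 < eta / 2 by rewrite divr_gt0.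
have [l1 [yl1 ll1 id1 tv1]] := IH y _ eta20 (le_trans Ax xy) yl lB.
have yB : y <= B.
  apply: le_trans lB; have : sorted <=%R (y :: unzip2 l) by [].
  by move=> /(order_path_min le_trans)/allP; case: (lastP (unzip2 l)) => // s z;
    rewrite last_rcons; apply; rewrite mem_rcons mem_head.
case: b => /=; last first.
  exists ((false, y) :: l1); split => //=; first by rewrite xy.
    by rewrite id1.
  rewrite !add0r (le_trans tv1)// lerD2l; lra.
have [_ [_ [s xs <-] <-]] :=
  ub_ereal_sup_adherent eta20 (total_variation_sub_fin Ax xy yB).
rewrite -/(total_variation x y F) -tv_funB// -EFinB lte_fin => tvs.
have [/path_lt_le xs' /eqP sy] := xs.
exists ([seq (true, z) | z <- s] ++ l1).
have usE : unzip2 [seq (true, z) | z <- s] = s.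
  by rewrite /unzip2 -map_comp map_id.
rewrite !flagged_variation_cat {1 2}/unzip2 !map_cat -!/(unzip2 _) usE.
rewrite flagged_variation_id// sy cat_path xs' sy last_cat sy; split => //.
  have -> : `|id y - id x| = y - x by rewrite ger0_norm ?subr_ge0.
  by rewrite id1.
rewrite (flagged_variation_variation _ _ y) ger0_norm; last first.
  by rewrite subr_ge0 le_tv_fun.
lra.
Qed.

Lemma ac_along_tv_fun : ac_along A B F -> ac_along A B (tv_fun A F).
Proof.
move=> acF e e0; have e20 : 0 < e / 2 by rewrite divr_gt0.
have [d d0 Hd] := acF _ e20; exists d => // x l Ax xl lB ld.
have [l' [xl' ll' idl' tvl]] := flagged_variation_refine e20 Ax xl lB.
apply: (le_lt_trans tvl); rewrite [ltRHS](splitr e) ltrD2r.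
by apply: Hd => //; rewrite ?ll' ?idl'.
Qed.

End refinement.

Lemma ac_along_continuous A B G : ac_along A B G ->
  forall e, 0 < e -> exists2 d, 0 < d & forall x y, A <= x -> x <= y -> y <= B ->
    y - x < d -> `|G y - G x| < e.
Proof.
move=> acG e /acG[d d0 Hd]; exists d => // x y Ax xy yB xyd.
have := Hd x [:: (true, y)] Ax; rewrite /= !addr0 andbT; apply => //.
by rewrite ger0_norm// subr_ge0.
Qed.

End ac_lists.

(** * Densities of nondecreasing absolutely continuous functions *)

Section stieltjes_density.
Set Implicit Arguments.
Unset Strict Implicit.
Context {R : realType}.
Variables (A B : R) (G : R -> R).
Hypothesis AB : A < B.
Hypothesis ndG : forall x y, A <= x -> x <= y -> y <= B -> G x <= G y.
Hypothesis acG : ac_along A B G.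
Notation mu := (@lebesgue_measure R).

(* Stieltjes measures come from functions on the whole line: outside [A, B] the
   function G is replaced by its values at A and B. *)
Let clamp (x : R) := Num.max A (Num.min x B).

Let clamp_id x : A <= x -> x <= B -> clamp x = x.
Proof. by move=> Ax xB; rewrite /clamp min_l// max_r. Qed.

Let clamp_itv x : A <= clamp x /\ clamp x <= B.
Proof.
rewrite /clamp le_max lexx ge_max (ltW AB) ge_min lexx orbT.
by split.
Qed.

Let clamp_le x y : x <= y -> clamp x <= clamp y.
Proof.
move=> xy; rewrite /clamp ge_max le_max lexx/= le_max.
by rewrite le_min !ge_min xy lexx !orbT.
Qed.

Let clamp_dist x y : x <= y -> clamp y - clamp x <= y - x.
Proof.
move=> xy; rewrite /clamp; have AB' := AB.
by case: (leP x B) => xB; case: (leP y B) => yB;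
  rewrite /Num.max; repeat case: ifP; lra.
Qed.

Let cG x := G (clamp x).

Let cG_nd : {homo cG : x y / x <= y}.
Proof.
move=> x y xy; apply: ndG; [exact: (clamp_itv x).1|exact: clamp_le|].
exact: (clamp_itv y).2.
Qed.

Let cG_rc : right_continuous cG.
Proof.
apply: right_continuousW => x; apply/cvgrPdist_lt => /= e e0.
have [d d0 Hd] := ac_along_continuous acG e0.
near=> y; have xy : `|x - y| < d by near: y; exact: cvgr_dist_lt.
have [yx|/ltW yx] := leP y x.
  apply: Hd; [exact: (clamp_itv y).1|exact: clamp_le|exact: (clamp_itv x).2|].
  by apply: le_lt_trans (clamp_dist yx) _; rewrite (le_lt_trans (ler_norm _)).
rewrite distrC.
apply: Hd; [exact: (clamp_itv x).1|exact: clamp_le|exact: (clamp_itv y).2|].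
apply: le_lt_trans (clamp_dist yx) _; by rewrite (le_lt_trans (ler_norm _)).
Unshelve. all: by end_near. Qed.

#[local] HB.instance Definition _ := isCumulative.Build R _ R cG cG_nd cG_rc.

Let nu : {measure set (measurableTypeR R) -> \bar R} :=
  lebesgue_stieltjes_measure cG.

Let nu_itv (a b : R) : A <= a -> a <= b -> b <= B ->
  nu `]a, b]%classic = (G b - G a)%:E.
Proof.
move=> Aa ab bB; rewrite /nu/= /lebesgue_stieltjes_measure /measure_extension/=.
rewrite measurable_mu_extE/=; last exact: is_ocitv.
rewrite wlength_itv_bnd// /cG !clamp_id//; first exact: le_trans bB.
exact: le_trans ab.
Qed.

Let t n i : R := A + i%:R * ((B - A) / n.+1%:R).
Let cell n i : set R := `]t n i, t n i.+1]%classic.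

Let tS n i : t n i.+1 = t n i + (B - A) / n.+1%:R.
Proof. by rewrite /t -[i.+1%:R]natr1; ring. Qed.

Let step_gt0 n : 0 < (B - A) / n.+1%:R.
Proof. by rewrite divr_gt0// subr_gt0. Qed.

Let t_le n i j : (i <= j)%N -> t n i <= t n j.
Proof. by move=> ij; rewrite lerD2l ler_wpM2r// ?ler_nat// ltW. Qed.

Let t0 n : t n 0%N = A. Proof. by rewrite /t mul0r addr0. Qed.

Let tn n : t n n.+1 = B.
Proof. by rewrite /t mulrC divfK// addrC subrK. Qed.

Let t_geA n i : A <= t n i. Proof. by rewrite -[leLHS](t0 n) t_le. Qed.

Let t_leB n i : (i <= n.+1)%N -> t n i <= B.
Proof. by move=> ?; rewrite -[leRHS](tn n) t_le. Qed.

Let inner (U : set R) n : set R :=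
  \big[setU/set0]_(i < n.+1 | `[< cell n i `<=` U >]) cell n i.

Let trivIset_cell n : trivIset setT (fun i : 'I_n.+1 => cell n i).
Proof.
apply/trivIsetP => i j _ _.
wlog ij : i j / (i < j)%N => [H|_].
  rewrite neq_ltn => /orP[|] ij; last rewrite setIC.
    by apply: H => //; rewrite neq_ltn ij.
  by apply: H => //; rewrite neq_ltn ij.
rewrite -subset0 => z []; rewrite /cell/= !in_itv/= => /andP[_ zv] /andP[tz _].
by have := lt_le_trans tz zv; rewrite ltNge t_le.
Qed.

Let measurable_cell n i : measurable (cell n i).
Proof. exact: measurable_itv. Qed.

Let measurable_inner U n : measurable (inner U n).
Proof. by apply: bigsetU_measurable => i _; exact: measurable_cell. Qed.

Let inner_sub U n : inner U n `<=` U.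
Proof.
rewrite /inner; elim/big_ind: _ => // [X Y XU YU|i /asboolP//].
by rewrite subUset.
Qed.

Let flags U n := [seq (`[< cell n i `<=` U >], t n i.+1) | i <- iota 0 n.+1].

Let nu_inner U n : nu (inner U n) = (flagged_variation G A (flags U n))%:E.
Proof.
rewrite /inner (measure_bigsetU_ord nu)//; last by move=> i; exact: measurable_cell.
rewrite -(t0 n) /flags flagged_variation_iota -sumEFin.
rewrite -[iota 0 n.+1]/(index_iota 0 n.+1) big_mkord.
apply: eq_bigr => i _.
rewrite [LHS](nu_itv (t_geA n i) (t_le n (leqnSn i)) _) ?t_leB//.
by rewrite ger0_norm// subr_ge0 ndG ?t_geA ?t_le ?t_leB.
Qed.

Let mu_inner U n : mu (inner U n) = (flagged_variation id A (flags U n))%:E.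
Proof.
rewrite /inner (measure_bigsetU_ord mu)//; last by move=> i; exact: measurable_cell.
rewrite -(t0 n) /flags flagged_variation_iota -sumEFin.
rewrite -[iota 0 n.+1]/(index_iota 0 n.+1) big_mkord.
apply: eq_bigr => i _.
rewrite [LHS](lebesgue_measure_itv `]t n i, t n i.+1])/= lte_fin.
rewrite ger0_norm ?subr_ge0 ?t_le//; case: ifPn => //.
by rewrite -leNgt tS gerDl leNgt step_gt0.
Qed.

Let inner_eventually (U : set R) (x : R) : open U -> U x -> A < x -> x <= B ->
  \forall n \near \oo, inner U n x.
Proof.
move=> oU Ux Ax xB.
have [r r0 rU] : exists2 r, 0 < r & ball x r `<=` U.
  by have /nbhs_ballP[r /= r0 rU] := open_nbhs_nbhs (conj oU Ux); exists r.
have rBA0 : 0 < r / (B - A) by rewrite divr_gt0// subr_gt0.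
near=> n.
have Hn : (B - A) / n.+1%:R < r.
  rewrite mulrC -ltr_pdivlMr ?subr_gt0//.
  by near: n; exact: (near_infty_natSinv_lt (PosNum rBA0)).
have [|[|i] xi imin] := @ex_minnP (fun j => x <= t n j).
- by exists n.+1; rewrite tn.
- by move: xi; rewrite t0 leNgt Ax.
have ix : t n i < x by rewrite ltNge; apply/negP => /imin; rewrite ltnn.
have iN : (i < n.+1)%N by apply: imin; rewrite tn.
have cU : cell n i `<=` U.
  apply: subset_trans rU => y; rewrite /cell/= in_itv/= /ball/= => /andP[iy yi].
  move: yi xi; rewrite tS => yi xi.
  rewrite ltr_norml; move: (t n i) (_ / _) ix iy yi xi Hn => ti st *.
  by apply/andP; split; lra.
rewrite /inner (bigD1 (Ordinal iN)) /=; last exact/asboolP.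
by left; rewrite /cell/= in_itv/= ix xi.
Unshelve. all: by end_near. Qed.

Let nu_le (X Y : set R) : measurable X -> measurable Y -> X `<=` Y ->
  (nu X <= nu Y)%E.
Proof. by move=> mX mY XY; apply: le_measure => //; exact: mem_set. Qed.

Let mu_le (X Y : set R) : measurable X -> measurable Y -> X `<=` Y ->
  (mu X <= mu Y)%E.
Proof. by move=> mX mY XY; apply: le_measure => //; exact: mem_set. Qed.

(* An open set is exhausted by the cells of the regular subdivisions that it
   contains.  The unions [inner U n] are not monotone in n, hence the passage
   to their inferior limit. *)
Let nu_open (U : set R) (e d : R) : open U ->
  (forall n, (flagged_variation id A (flags U n) < d) ->
     (flagged_variation G A (flags U n) < e)) ->
  (mu U < d%:E)%E -> (nu (U `&` `]A, B]%classic) <= e%:E)%E.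
Proof.
move=> oU Hd Ud.
pose F n := \bigcap_(k in [set k | (n <= k)%N]) inner U k.
have mF n : measurable (F n).
  apply: bigcap_measurable => [|k _]; last exact: measurable_inner.
  by exists n => /=.
have mUF : measurable (\bigcup_n F n) by exact: bigcup_measurable.
have nuF n : (nu (F n) <= e%:E)%E.
  apply: (@le_trans _ _ (nu (inner U n))).
    by apply: nu_le => // x; apply => /=.
  rewrite nu_inner lee_fin ltW// Hd// -lte_fin -mu_inner.
  apply: le_lt_trans Ud; apply: mu_le => //.
  exact: open_measurable.
have : nu \o F @ \oo --> nu (\bigcup_n F n).
  apply: nondecreasing_cvg_mu => // m n mn; apply/subsetPset => x Fmx k /= nk.
  by apply: Fmx => /=; exact: leq_trans nk.
move=> nuUF; apply: (@le_trans _ _ (nu (\bigcup_n F n))).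
  apply: nu_le => //.
    by apply: measurableI => //; exact: open_measurable.
  move=> x [Ux]; rewrite /= in_itv/= => /andP[Ax xB].
  have [N _ HN] := inner_eventually oU Ux Ax xB.
  by exists N => // k /= Nk; exact: HN.
by apply: cvge_le nuUF; exact: nearW.
Qed.

Let nu_AB : (nu `]A, B]%classic < +oo)%E.
Proof. by rewrite nu_itv ?ltry// ltW. Qed.

Let mAB : measurable (`]A, B]%classic : set (measurableTypeR R)).
Proof. exact: measurable_itv. Qed.

Let nuAB : {finite_measure set (measurableTypeR R) -> \bar R} :=
  mfrestr mAB nu_AB.

(* A Lebesgue null set lies in an open set of measure less than d; the cells
   inside that open set have total length less than d, hence carry a variation
   of G less than e. *)
Let nuAB_dominated : nuAB `<< mu.
Proof.
apply/null_content_dominatesP => N mN N0.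
apply/eqP; rewrite eq_le measure_ge0 andbT.
apply/lee_addgt0Pr => e e0; rewrite add0e.
have [d d0 Hd] := acG e0.
have [U [oU NU UN]] : exists U : set R, [/\ open U, N `<=` U & (mu U < d%:E)%E].
  have [|U [oU NU UN]] := lebesgue_regularity_outer mN _ d0.
    by rewrite [X in (X < _)%E]N0.
  exists U; split=> //; apply: le_lt_trans UN.
  have mU : measurable U by exact: open_measurable.
  rewrite -{1}(setDUK NU); apply: le_trans (measureU2 _ _ _) _ => //.
    exact: measurableD.
  by rewrite [X in (X + _)%E]N0 add0e.
apply: (@le_trans _ _ (nu (U `&` `]A, B]%classic))).
  rewrite /nuAB /mfrestr /mrestr/=; apply: nu_le.
  - exact: measurableI.
  - by apply: measurableI => //; exact: open_measurable.
  - exact: setSI.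
apply: (nu_open oU _ UN) => n.
have gridE : A :: unzip2 (flags U n) = [seq t n i | i <- iota 0 n.+2].
  rewrite -[iota 0 n.+2]/(0%N :: iota 1 n.+1) map_cons t0; congr cons.
  by rewrite /flags /unzip2 -map_comp (iotaDl 1 0) -map_comp.
apply: Hd => //.
  rewrite -[path _ _ _]/(sorted <=%R (A :: unzip2 (flags U n))) gridE.
  apply: (homo_sorted (e := leq)); first exact: t_le.
  exact: iota_sorted.
rewrite -[last _ _]/(last A (A :: unzip2 (flags U n))) gridE.
by rewrite -(t0 n) last_map -[n.+2]addn1 iotaD last_cat /= add0n tn.
Qed.

Lemma nondecreasing_ac_density : exists phi : R -> R, L1 phi /\
  forall x, A <= x -> x <= B -> G x - G A = \int[mu]_(y in `]A, x]) phi y.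
Proof.
have [phi [phi_ge0 phi_fin phi_int phiE]] :=
  radon_nikodym_sigma_finite nuAB_dominated.
exists (fine \o phi); split.
  by apply: eq_integrable phi_int => // x _ /=; rewrite fineK.
move=> x Ax xB; rewrite /Rintegral.
under eq_integral do rewrite /= fineK//.
rewrite -phiE; last exact: measurable_itv.
rewrite /nuAB /= /mfrestr /mrestr/= (_ : _ `&` _ = `]A, x]%classic).
  by rewrite nu_itv.
apply/seteqP; split => [y [] //|y Axy]; split => //.
by move: Axy; rewrite /= !in_itv/= => /andP[-> /le_trans->].
Qed.

End stieltjes_density.

(** * The fundamental theorem of calculus *)

Section primitives.
Set Implicit Arguments.
Unset Strict Implicit.
Context {R : realType}.
Implicit Types F g : R -> R.
Notation mu := (@lebesgue_measure R).

(** Stating that [F] is an indefinite integral of [g], rather than that [g] is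
    the derivative of [F], treats [C^1] and absolutely continuous functions
    uniformly. *)
Definition is_primitive F g : Prop :=
  (forall x y, mu.-integrable `[x, y] (EFin \o g)) /\
  (forall x y, x <= y -> F y - F x = \int[mu]_(z in `[x, y]) g z).

(** [F = V - (V - F)], where [V] is the total variation of [F] from [A]; both
    [V] and [V - F] are nondecreasing, because an increment of [F] is at most
    that of [V]. *)
Lemma ac_along_density A B F : A < B -> ac_along A B F ->
  exists phi : R -> R, L1 phi /\
    forall x, A <= x -> x <= B -> F x - F A = \int[mu]_(y in `]A, x]) phi y.
Proof.
move=> AB acF; have bvF := ac_along_bounded_variation (ltW AB) acF.
have acV := ac_along_tv_fun bvF acF.
have [|v [v1 vE]] := nondecreasing_ac_density AB _ acV.
  by move=> x y Ax xy yB; exact: (le_tv_fun bvF).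
have [|w [w1 wE]] := nondecreasing_ac_density AB _ (ac_alongB acV acF).
  move=> x y Ax xy yB /=.
  have := le_trans (ler_norm _) (tv_fun_ge bvF Ax xy yB); lra.
exists (v \- w); split; first exact: (integrableB measurableT v1 w1).
move=> x Ax xB; rewrite RintegralB//.
- by rewrite -vE// -wE//=; ring.
- exact: integrableS v1.
- exact: integrableS w1.
Qed.

Let derive_subr F (k z : R) : 'D_1 (fun w => F w - k) z = 'D_1 F z.
Proof.
rewrite /derive; set u := (fun h => _); set v := (fun h => _).
suff -> : u = v by [].
by apply/funext => h; rewrite /u /v /= opprB addrA subrK.
Qed.

(** The density [phi] given by [ac_along_density] is almost everywhere the
    derivative of [F], so it may be replaced by [derive1 F] in the integral,
    whatever values [derive1 F] takes where [F] is not differentiable. *)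
Lemma abs_continuous_primitive F :
  abs_continuous F -> L1 (derive1 F) -> is_primitive F (derive1 F).
Proof.
move=> acF F1; split=> [x y|x y xy]; first exact: integrableS F1.
move: xy; rewrite le_eqVlt => /predU1P[->|xy].
  by rewrite subrr set_itv1 Rintegral_set1.
have [phi [phi1 phiE]] :=
  ac_along_density xy (abs_continuous_on_along (acF x y)).
rewrite phiE//; last exact: ltW.
have intphi (i : interval R) : mu.-integrable [set` i] (EFin \o phi).
  by apply: integrableS phi1 => //.
have intF (i : interval R) : mu.-integrable [set` i] (EFin \o derive1 F).
  by apply: integrableS F1 => //.
rewrite -Rintegral_itv_bndo_bndc// -[RHS]Rintegral_itv_bndo_bndc//.
rewrite -[RHS]Rintegral_itv_obnd_cbnd//.
have locphi : locally_integrable setT phi.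
  exact: open_integrable_locally openT phi1.
have /= aeF := @FTC1 R phi (BRight x) (fun y => intphi _) locphi.
congr fine; apply: ae_eq_integral => //.
- by have /integrableP[] := intphi `]x, y[.
- by have /integrableP[] := intF `]x, y[.
apply: filterS aeF; first exact: (ae_filter_ringOfSetsType mu).
move=> z + xzy; move: xzy; rewrite /= in_itv/= => /andP[xz zy].
rewrite lte_fin => /(_ xz)[_ IE]; congr EFin; rewrite -IE !derive1E.
rewrite (@near_eq_derive _ _ _ _ (fun w => F w - F x)).
  exact: derive_subr.
near=> w; rewrite phiE//.
- by apply: ltW; near: w; exact: lt_nbhsr.
- by apply: ltW; near: w; exact: lt_nbhsl.
Unshelve. all: by end_near. Qed.

Lemma C1_primitive F : (forall x, derivable F x 1) -> continuous (derive1 F) ->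
  is_primitive F (derive1 F).
Proof.
move=> dF cF'; split=> [x y|x y].
  apply: continuous_compact_integrable; first exact: segment_compact.
  exact: continuous_subspaceT.
rewrite le_eqVlt => /predU1P[->|xy].
  by rewrite subrr set_itv1 Rintegral_set1.
have cF : continuous F.
  by move=> z; exact/differentiable_continuous/derivable1_diffP.
rewrite /Rintegral (continuous_FTC2 xy _ _ (fun _ _ => erefl))//=.
  exact: continuous_subspaceT.
split; first by move=> *; exact: dF.
- by apply: cvg_at_right_filter; exact: cF.
- by apply: cvg_at_left_filter; exact: cF.
Qed.

End primitives.

(** * Affine changes of variables *)

Section affine.
Set Implicit Arguments.
Unset Strict Implicit.
Context {R : realType}.
Notation mu := (@lebesgue_measure R).
Variables (c d : R).
Hypothesis c0 : c != 0.

Let aff (x : R) := c * x + d.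

Let maff : measurable_fun setT (aff : measurableTypeR R -> measurableTypeR R).
Proof.
apply: continuous_measurable_fun => x; apply: cvgD; last exact: cvg_cst.
by apply: cvgM; [exact: cvg_cst|exact: cvg_id].
Qed.

Let c_ge0 : 0 <= `|c|. Proof. exact: normr_ge0. Qed.

Let pf : {measure set (measurableTypeR R) -> \bar R} :=
  measure_function_pushforward__canonical__measure_function_Measure mu maff.

Let scaled : {measure set (measurableTypeR R) -> \bar R} :=
  mscale (NngNum c_ge0) pf.

(* Both measures give the same length to half-open intervals.  When c < 0 the
   preimage of such an interval is closed on the other side. *)
Let lebesgue_affine A : measurable A -> mu A = scaled A.
Proof.
apply: lebesgue_measure_unique => _ [[a b] /= _ <-].
rewrite /scaled/= /mscale/= /pushforward.
have [c_lt0|c_gt0|c_eq0] := ltgtP c 0; last by have := c0; rewrite c_eq0 eqxx.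
- have -> : aff @^-1` `]a, b] = [set` `[(b - d) / c, (a - d) / c[].
    apply/seteqP; split => x; rewrite /aff/= !in_itv/= ler_ndivrMr//;
      by rewrite ltr_ndivlMr// ltrBlDr lerBrDr mulrC andbC.
  rewrite !lebesgue_measure_itv/= !lte_fin ltr_nM2r ?invr_lt0// ltrD2r.
  case: ifPn => _; last by rewrite mule0.
  by rewrite -!EFinB -EFinM; congr EFin; rewrite ltr0_norm//; field.
- have -> : aff @^-1` `]a, b] = [set` `](a - d) / c, (b - d) / c]].
    apply/seteqP; split => x; rewrite /aff/= !in_itv/= ltr_pdivrMr//;
      by rewrite ler_pdivlMr// ltrBlDr lerBrDr mulrC.
  rewrite !lebesgue_measure_itv/= !lte_fin ltr_pM2r ?invr_gt0// ltrD2r.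
  case: ifPn => _; last by rewrite mule0.
  by rewrite -!EFinB -EFinM; congr EFin; rewrite gtr0_norm//; field.
Qed.

Lemma ge0_integral_affine (f : R -> \bar R) : measurable_fun setT f ->
  (forall x, 0 <= f x)%E ->
  (\int[mu]_x f (c * x + d)%R = (`|c|^-1)%:E * \int[mu]_x f x)%E.
Proof.
move=> mf f0.
rewrite [X in (_ * X)%E](eq_measure_integral scaled); last first.
  by move=> A mA _; exact: lebesgue_affine.
rewrite ge0_integral_mscale//= ge0_integral_pushforward//.
by rewrite preimage_setT muleA -EFinM mulVf ?normr_eq0// mul1e.
Qed.

Lemma integrable_affine (f : R -> R) : L1 f -> L1 (fun x => f (c * x + d)).
Proof.
move=> /integrableP[mf f1]; apply/integrableP; split.
  exact: (measurableT_comp mf maff).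
rewrite (@ge0_integral_affine (fun x => `|(f x)%:E|%E))//.
  by rewrite lte_mul_pinfty// lee_fin invr_ge0.
exact: measurableT_comp.
Qed.

Lemma Rintegral_affine (f : R -> R) : L1 f ->
  \int[mu]_x f (c * x + d) = `|c|^-1 * \int[mu]_x f x.
Proof.
move=> f1; have /integrableP[mf _] := f1.
rewrite /Rintegral -[`|c|^-1]/(fine (`|c|^-1)%:E).
have fin_pos : (\int[mu]_x (EFin \o f)^\+ x)%E \is a fin_num.
  exact: (integrable_pos_fin_num measurableT f1).
have fin_neg : (\int[mu]_x (EFin \o f)^\- x)%E \is a fin_num.
  exact: (integrable_neg_fin_num measurableT f1).
rewrite -fineM//; last by rewrite integralE fin_numB fin_pos.
congr fine; rewrite [LHS]integralE [in RHS]integralE.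
rewrite muleBr//; last exact: fin_num_adde_defr.
rewrite -!ge0_integral_affine//;
  [|exact: measurable_funeneg|exact: measurable_funepos].
by congr (_ - _)%E; apply: eq_integral => x _; rewrite ?funeposE ?funenegE.
Qed.

End affine.

(** * Integrals over the unit segment *)

Section unit_segment.
Set Implicit Arguments.
Unset Strict Implicit.
Context {R : realType}.
Notation mu := (@lebesgue_measure R).
Implicit Types F g : R -> R.

(** Parametrizing the segment from [x] to [x + t] by [[0, 1]] covers both signs
    of [t] at once. *)
Lemma primitive_segment F g x t : is_primitive F g ->
  mu.-integrable `[0, 1] (EFin \o (fun th => g (x + t * th))) /\
  F (x + t) - F x = t * \int[mu]_(th in `[0, 1]) g (x + t * th).
Proof.
move=> [intg FE].
have [->|t0] := eqVneq t 0.
  rewrite addr0 subrr mul0r; split=> //.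
  have -> : (fun th => g (x + 0 * th)) = cst (g x).
    by apply/funext => th; rewrite mul0r addr0.
  apply: continuous_compact_integrable; first exact: segment_compact.
  by apply: continuous_subspaceT => ?; exact: cvg_cst.
pose lo := Num.min x (x + t); pose hi := Num.max x (x + t).
pose G := g \_ `[lo, hi].
have G1 : L1 G.
  by rewrite /L1 /G -restrict_EFin; apply/integrable_restrict; rewrite ?setTI.
have GE : (fun th => G (t * th + x)) = (fun th => g (x + t * th)) \_ `[0, 1].
  apply/funext => th; rewrite /G !patchE addrC; congr (if _ then _ else _).
  have lohi : (x + t * th \in `[lo, hi]) = (th \in `[0, 1]).
    rewrite !in_itv/= /lo /hi; have [t_lt0|t_gt0|t_eq0] := ltgtP t 0.
    - rewrite min_r ?max_l; [|lra|lra].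
      by apply/idP/idP => /andP[? ?]; apply/andP; split; nra.
    - rewrite min_l ?max_r; [|lra|lra].
      by apply/idP/idP => /andP[? ?]; apply/andP; split; nra.
    - by rewrite t_eq0 eqxx in t0.
  apply/idP/idP; rewrite !inE /=.
    by rewrite lohi.
  by rewrite lohi.
have int01 : mu.-integrable setT (EFin \o (fun th => G (t * th + x))).
  exact: integrable_affine.
split.
  apply/integrable_mkcond; first exact: measurable_itv.
  by rewrite restrict_EFin -GE.
rewrite Rintegral_mkcond -GE Rintegral_affine// /G -Rintegral_mkcond.
rewrite /lo /hi mulrA; have [t_lt0|t_gt0|t_eq0] := ltgtP t 0.
- rewrite min_r ?max_l; [|lra|lra].
  rewrite -FE; last by lra.
  by rewrite ltr0_norm// invrN mulrN mulfV// mulN1r opprB.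
- rewrite min_l ?max_r; [|lra|lra].
  rewrite -FE; last by lra.
  by rewrite gtr0_norm// mulfV// mul1r.
- by rewrite t_eq0 eqxx in t0.
Qed.

Let exprn_primitive n : is_primitive (fun x : R => x ^+ n.+1)
  (fun x => n.+1%:R * x ^+ n).
Proof.
have dE : derive1 (fun x : R => x ^+ n.+1) = (fun x => n.+1%:R * x ^+ n).
  by apply/funext => x; rewrite exp_derive1.
rewrite -dE; apply: C1_primitive; first by move=> x; exact: exprn_derivable.
rewrite dE => x; apply: cvgM; [exact: cvg_cst|exact: exprn_continuous].
Qed.

Lemma Rintegral_exprn01 n :
  mu.-integrable `[0, 1] (EFin \o (fun th : R => th ^+ n)) /\
  \int[mu]_(th in `[0, 1]) th ^+ n = n.+1%:R^-1.
Proof.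
have intn : mu.-integrable `[0, 1] (EFin \o (fun th : R => th ^+ n)).
  apply: continuous_compact_integrable; first exact: segment_compact.
  by apply: continuous_subspaceT; exact: exprn_continuous.
split=> //; have [_ /(_ 0 1 ler01)] := exprn_primitive n.
rewrite expr1n expr0n subr0 RintegralZl// => E.
by apply: (mulfI (_ : n.+1%:R != 0)); rewrite // -E mulfV.
Qed.

Lemma Rintegral_sub_lincomb d (T : measurableType d)
    (m : {measure set T -> \bar R}) (E : set T) (G : T -> R) n
    (b : nat -> R) (phi : nat -> T -> R) : measurable E ->
  m.-integrable E (EFin \o G) ->
  (forall j, (j < n)%N -> m.-integrable E (EFin \o phi j)) ->
  m.-integrable E (EFin \o (fun x => G x - \sum_(j < n) b j * phi j x)) /\
  \int[m]_(x in E) (G x - \sum_(j < n) b j * phi j x) =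
  \int[m]_(x in E) G x - \sum_(j < n) b j * \int[m]_(x in E) phi j x.
Proof.
move=> mE intG; elim: n => [_|n IHn intphi].
  rewrite big_ord0 subr0.
  have -> : (fun x => G x - \sum_(j < 0) b j * phi j x) = G.
    by apply/funext => x; rewrite big_ord0 subr0.
  by split.
have [j jn|intn IH] := IHn; first by apply: intphi; exact: ltnW.
have -> : (fun x => G x - \sum_(j < n.+1) b j * phi j x) =
    (fun x => (G x - \sum_(j < n) b j * phi j x) - b n * phi n x).
  by apply/funext => x; rewrite big_ord_recr opprD addrA.
have intp := intphi n (ltnSn n).
have intbp : m.-integrable E (EFin \o (fun x => b n * phi n x)).
  exact: (integrableZl mE (b n) intp).
split; first exact: (integrableB mE intn intbp).
by rewrite RintegralB// RintegralZl// IH big_ord_recr opprD addrA.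
Qed.

End unit_segment.

(** * Taylor remainders in the mean *)

Section taylor_remainder.
Set Implicit Arguments.
Unset Strict Implicit.
Context {R : realType}.
Notation mu := (@lebesgue_measure R).
Variables (D : nat -> R -> R) (s : nat).
Hypothesis D_primitive : forall k, (k < s)%N -> is_primitive (D k) (D k.+1).
Hypothesis D_measurable : forall k, (k <= s)%N -> measurable_fun setT (D k).

(** In the sequence [D] every function is a primitive of the next one; this is
    the remainder of order [k] of [D m] at [x], with increment [t]. *)
Definition taylor_rem (m k : nat) (x t : R) : R :=
  D m (x + t) - \sum_(j < k.+1) t ^+ j / j`!%:R * D (m + j) x.

(** Integrating over [[0, 1]] the terms [(t * th)^j / j!] and multiplying by [t]
    gives [t^(j+1) / (j+1)!]; the term of order 0 on the left comes from
    [D m (x + t) - D m x], the integral of [D m.+1]. *)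
Lemma taylor_remS m k x t : (m < s)%N ->
  mu.-integrable `[0, 1] (EFin \o (fun th => taylor_rem m.+1 k x (t * th))) /\
  taylor_rem m k.+1 x t =
  t * \int[mu]_(th in `[0, 1]) taylor_rem m.+1 k x (t * th).
Proof.
move=> ms; have [intD DE] := primitive_segment x t (D_primitive ms).
have remE : (fun th => taylor_rem m.+1 k x (t * th)) =
    (fun th => D m.+1 (x + t * th) -
      \sum_(j < k.+1) (t ^+ j / j`!%:R * D (m.+1 + j) x) * th ^+ j).
  apply/funext => th; rewrite /taylor_rem; congr (_ - _).
  by apply: eq_bigr => j _; rewrite exprMn; ring.
rewrite remE.
have [||intrem ->] := @Rintegral_sub_lincomb R _ _ mu `[0, 1]%classic _ k.+1
  (fun j => t ^+ j / j`!%:R * D (m.+1 + j) x) (fun j (th : R) => th ^+ j) _ intD.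
- exact: measurable_itv.
- by move=> j _; exact: (Rintegral_exprn01 j).1.
split=> //; rewrite mulrBr -DE /taylor_rem big_ord_recl /=.
rewrite expr0 fact0 divr1 mul1r addn0 opprD addrA; congr (_ - _).
rewrite mulr_sumr; apply: eq_bigr => j _; rewrite (Rintegral_exprn01 j).2.
rewrite /bump /= add1n exprS factS natrM addSnnS.
have f0 : j`!%:R != 0 :> R by rewrite pnatr_eq0 -lt0n fact_gt0.
by field; rewrite f0 nat1r pnatr_eq0.
Qed.

Lemma measurable_taylor_rem m k : (m + k <= s)%N ->
  measurable_fun setT (fun z : measurableTypeR R * measurableTypeR R =>
    taylor_rem m k z.1 z.2).
Proof.
move=> mks; apply: measurable_funB.
  apply: (measurableT_comp (D_measurable _)).
    exact: leq_trans (leq_addr _ _) mks.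
  exact: measurable_funD.
apply: measurable_sum => j; apply: measurable_funM.
  by apply: measurable_funM => //; exact: measurable_funX.
apply: (measurableT_comp (D_measurable _)) => //.
by apply: leq_trans mks; rewrite leq_add2l -ltnS.
Qed.

Lemma measurable_taylor_rem1 m k t : (m + k <= s)%N ->
  measurable_fun setT (fun x => `|taylor_rem m k x t|%:E).
Proof.
move=> mks; apply/measurable_EFinP; apply: measurableT_comp => //.
exact: (measurable_fun_pair1 t (measurable_taylor_rem mks)).
Qed.

Variables (a c : R).
Hypothesis a_gt0 : 0 < a.
Hypothesis c_ge0 : 0 <= c.
Hypothesis D_modulus : forall t,
  (\int[mu]_x `|D s (x + t) - D s x|%:E <= (c * `|t| `^ a)%:E)%E.

(** By [taylor_remS] and Tonelli, the bound at order [k + 1] is [|t|] times an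
    average over [th] in [[0, 1]] of the bounds [c |t * th|^(k + a)] at order
    [k], each of which is at most [c |t|^(k + a)]. *)
Lemma norm1_taylor_rem m k t : (m + k = s)%N ->
  (norm1 (taylor_rem m k ^~ t) <= (c * `|t| `^ (k%:R + a))%:E)%E.
Proof.
elim: k m t => [m t|k IH m t mks].
  rewrite addn0 add0r => ->; apply: le_trans (D_modulus t).
  rewrite le_eqVlt; apply/orP; left; apply/eqP; apply: eq_integral => x _.
  by rewrite /taylor_rem big_ord1 expr0 fact0 invr1 !mul1r addn0.
have ms : (m < s)%N by rewrite -mks addnS ltnS leq_addr.
have mks' : (m.+1 + k = s)%N by rewrite -mks addnS.
(* The indicator function turns the integral over the unit segment into one
   over the line, to which Tonelli applies. *)
pose h (z : measurableTypeR R * measurableTypeR R) : \bar R := 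
  (`|taylor_rem m.+1 k z.1 (t * z.2)| * \1_(`[0, 1]%classic) z.2)%:E.
have mh : measurable_fun setT h.
  apply/measurable_EFinP; apply: measurable_funM.
    apply: measurableT_comp => //.
    have mks1 : (m.+1 + k <= s)%N by rewrite mks'.
    apply: (measurableT_comp (measurable_taylor_rem mks1)
      (g := fun z => (z.1, t * z.2))).
    by apply: measurable_fun_pair => //; exact: measurable_funM.
  exact: measurableT_comp.
have h_ge0 z : (0 <= h z)%E by rewrite lee_fin mulr_ge0.
have h_int x : (\int[mu]_th h (x, th) =
    \int[mu]_(th in `[0%R, 1%R]) `|taylor_rem m.+1 k x (t * th)|%:E)%E.
  rewrite [RHS]integral_mkcond; apply: eq_integral => th _.
  by rewrite /h patchE indicE; case: ifP; rewrite ?mulr1 ?mulr0.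
have h_int' th : (\int[mu]_x h (x, th) = (\1_(`[0%R, 1%R]%classic) th)%:E *
    norm1 (fun x => taylor_rem m.+1 k x (t * th)))%E.
  under eq_integral do rewrite /h /= mulrC EFinM.
  rewrite ge0_integralZl//.
  by apply: measurable_taylor_rem1; rewrite mks'.
have mh_int : measurable_fun setT (fun x => \int[mu]_th h (x, th))%E.
  exact: measurable_fun_fubini_tonelli_F.
have mh_int' : measurable_fun setT (fun th => \int[mu]_x h (x, th))%E.
  exact: measurable_fun_fubini_tonelli_G.
apply: (@le_trans _ _ (\int[mu]_x (`|t|%:E * \int[mu]_th h (x, th)))%E).
  apply: ge0_le_integral => //.
  - by apply: measurable_taylor_rem1; rewrite mks.
  - exact: measurable_funeM.
  move=> x _; have [intr ->] := taylor_remS k x t ms.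
  rewrite h_int normrM EFinM lee_wpmul2l//.
  rewrite -abse_EFin fineK; last exact: integrable_fin_num intr.
  by apply: le_abse_integral => //; have /integrableP[] := intr.
rewrite ge0_integralZl//; last by move=> x _; exact: integral_ge0.
rewrite fubini_tonelli//.
pose C := c * `|t| `^ (k%:R + a).
have C_ge0 : 0 <= C by rewrite mulr_ge0 ?powR_ge0.
apply: (@le_trans _ _ (`|t|%:E * C%:E)%E).
  rewrite lee_wpmul2l//.
  apply: (@le_trans _ _
      (\int[mu]_th (C%:E * (\1_(`[0%R, 1%R]%classic) th)%:E))%E).
    apply: ge0_le_integral => //.
    - by move=> th _; exact: integral_ge0.
    - apply: measurable_funeM; apply/measurable_EFinP.
      exact: measurable_indic.
    move=> th _; rewrite h_int' muleC indicE.
    have [|_] := boolP (th \in _); last by rewrite !mule0.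
    rewrite inE /= in_itv/= => /andP[th0 th1]; rewrite !mule1.
    apply: (le_trans (IH _ _ mks')); rewrite lee_fin ler_wpM2l//.
    apply: ge0_ler_powR; rewrite ?nnegrE//.
      by rewrite addr_ge0// ltW.
    by rewrite normrM ler_piMr// ger0_norm.
  rewrite ge0_integralZl//; last first.
    by apply/measurable_EFinP; exact: measurable_indic.
  rewrite integral_indic// setIT.
  rewrite [X in (_ * X)%E](lebesgue_measure_itv `[0%R, 1%R])/= lte_fin ltr01.
  by rewrite oppr0 addr0 mule1.
rewrite -EFinM lee_fin /C mulrCA ler_wpM2l//.
have [->|t0] := eqVneq t 0.
  by rewrite normr0 mul0r powR_ge0.
rewrite -natr1 addrAC [leRHS]powRD; last by rewrite normr_eq0 t0 implybT.
by rewrite powRr1// mulrC.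
Qed.

End taylor_remainder.

(** * The error of a convolution *)

Section convolution_error.
Set Implicit Arguments.
Unset Strict Implicit.
Context {R : realType}.
Notation mu := (@lebesgue_measure R).
Variables (D : nat -> R -> R) (s : nat).
Hypothesis s_gt0 : (0 < s)%N.
Hypothesis D_primitive : forall k, (k < s)%N -> is_primitive (D k) (D k.+1).
Hypothesis D_measurable : forall k, (k <= s)%N -> measurable_fun setT (D k).
Variables (a c : R).
Hypothesis a_gt0 : 0 < a.
Hypothesis c_ge0 : 0 <= c.
Hypothesis D_modulus : forall t,
  (\int[mu]_x `|D s (x + t) - D s x|%:E <= (c * `|t| `^ a)%:E)%E.
Variable K : R -> R.
Hypothesis K_kernel : is_kernel K.
Hypothesis K_moment : forall j, (1 <= j <= s)%N -> L1 (fun t => t ^+ j * K t).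
Hypothesis K_alpha0 : forall j, (1 <= j < s)%N -> alpha j K = 0.
Hypothesis K_beta : (beta (s%:R + a) K < +oo)%E.

Let mK : measurable_fun setT K.
Proof. by have [/integrableP[/measurable_EFinP]] := K_kernel. Qed.

Let weighted_rem (z : measurableTypeR R * measurableTypeR R) : R :=
  K z.2 * taylor_rem D 0 s z.1 (- z.2).

Let measurable_weighted_rem : measurable_fun setT weighted_rem.
Proof.
apply: measurable_funM; first exact: measurableT_comp.
have mrem := measurable_taylor_rem D_measurable (leqnn (0 + s)).
apply: (measurableT_comp mrem (g := fun z : measurableTypeR R *
  measurableTypeR R => (z.1, - z.2))).
by apply: measurable_fun_pair => //; exact: measurableT_comp.
Qed.

Let measurable_abs_rem : measurable_fun setT (fun z => `|weighted_rem z|%:E).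
Proof. by apply/measurable_EFinP; exact: measurableT_comp. Qed.

Let measurable_abs_rem_x :
  measurable_fun setT (fun x => \int[mu]_u `|weighted_rem (x, u)|%:E)%E.
Proof. exact: (measurable_fun_fubini_tonelli_F (fun z => `|weighted_rem z|%:E)). Qed.

Let integral_weighted_rem :
  (\int[mu]_x \int[mu]_u `|weighted_rem (x, u)|%:E <=
   c%:E * beta (s%:R + a) K)%E.
Proof.
rewrite (fubini_tonelli (fun z => `|weighted_rem z|%:E))//.
have mbeta : measurable_fun setT
    (fun t : R => (`|t| `^ (s%:R + a) * `|K t|)%:E).
  apply/measurable_EFinP; apply: measurable_funM; last exact: measurableT_comp.
  exact: (measurableT_comp (measurable_powR _)).
rewrite /beta -ge0_integralZl//.
apply: ge0_le_integral => //.
- by move=> u _; exact: integral_ge0.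
- exact: (measurable_fun_fubini_tonelli_G (fun z => `|weighted_rem z|%:E)).
- exact: measurable_funeM.
move=> u _; rewrite /weighted_rem /=.
under eq_integral do rewrite normrM EFinM.
have mrem := measurable_taylor_rem1 D_measurable (- u) (leqnn (0 + s)).
rewrite ge0_integralZl//.
rewrite EFinM muleA muleC lee_pmul//; first exact: integral_ge0.
have := norm1_taylor_rem D_primitive D_measurable a_gt0 c_ge0 D_modulus
  (- u) (add0n s).
by rewrite normrN EFinM.
Qed.

Let weighted_rem_integrable :
  {ae mu, forall x, mu.-integrable setT (fun u => (weighted_rem (x, u))%:E)}.
Proof.
have : mu.-integrable setT (fun x => \int[mu]_u `|weighted_rem (x, u)|%:E)%E.
  apply/integrableP; split => //.
  under eq_integral do rewrite gee0_abs ?integral_ge0//.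
  apply: (le_lt_trans integral_weighted_rem).
  by rewrite lte_mul_pinfty// lee_fin.
move=> /(integrable_ae measurableT) aefin.
apply: filterS aefin.
move=> x /(_ I) fin; apply/integrableP; split.
  apply/measurable_EFinP.
  exact: (measurable_fun_pair2 x measurable_weighted_rem).
by rewrite -ge0_fin_numE ?integral_ge0.
Qed.

Let K_moment0 j : (j <= s)%N -> L1 (fun t => t ^+ j * K t).
Proof.
case: j => [_|j js]; last exact: K_moment.
have [K1 _] := K_kernel.
have -> : (fun t => t ^+ 0 * K t) = K by apply/funext => t; rewrite expr0 mul1r.
by [].
Qed.

(* The identity holds where the weighted remainder is integrable in u: there
   the integrand of the convolution is a finite sum of integrable functions. *)
Let convolution_taylor x :
  mu.-integrable setT (fun u => (weighted_rem (x, u))%:E) ->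
  convolution (D 0) K x - D 0 x =
  \int[mu]_u weighted_rem (x, u) + (-1) ^+ s / s`!%:R * alpha s K * D s x.
Proof.
move=> intT.
pose b j := - ((-1) ^+ j / j`!%:R * D j x).
have [||_ E] := @Rintegral_sub_lincomb R _ _ mu setT
    (fun u => weighted_rem (x, u)) s.+1 b (fun j u => u ^+ j * K u) _ intT.
- exact: measurableT.
- by move=> j; rewrite ltnS; exact: K_moment0.
have -> : convolution (D 0) K x = \int[mu]_u (weighted_rem (x, u) -
    \sum_(j < s.+1) b j * (u ^+ j * K u)).
  apply: eq_Rintegral => u _; rewrite /weighted_rem /= /taylor_rem.
  rewrite mulrBr -addrA -opprD -[LHS]subr0; congr (_ - _).
  rewrite mulr_sumr -big_split/= big1// => j _.
  by rewrite /b (exprNn u) add0n; ring.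
rewrite E (bigD1 ord0)//= (bigD1 ord_max)/=; last first.
  by rewrite -(inj_eq val_inj) /= -lt0n.
rewrite big1 => [|j /andP[j0 jmax]]; last first.
  rewrite -/(alpha j K) K_alpha0 ?mulr0//.
  rewrite lt0n [(nat_of_ord j == 0)%N](_ : _ = (j == ord0))// j0/=.
  rewrite ltn_neqAle -ltnS ltn_ord andbT.
  by rewrite -[s in X in _ != X]/(nat_of_ord (@ord_max s)) (inj_eq val_inj).
have [_ K1] := K_kernel.
have -> : \int[mu]_u (u ^+ 0 * K u) = 1.
  by rewrite -K1; apply: eq_Rintegral => u _; rewrite expr0 mul1r.
by rewrite -/(alpha s K) /b expr0 fact0; field.
Qed.

(** The weighted remainder is integrable in [u] for almost every [x], since its
    double integral is finite; at these points the convolution is given by the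
    moments of [K] of order at most [s], which vanish but at orders 0 and [s]. *)
Lemma norm1_convolution_sub :
  (norm1 (fun x => convolution (D 0%N) K x - D 0%N x)%R <=
   (`|alpha s K| / s`!%:R)%:E * norm1 (D s) + c%:E * beta (s%:R + a) K)%E.
Proof.
have mDs : measurable_fun setT (D s) by exact: D_measurable.
have mnDs : measurable_fun setT (fun x => `|D s x|%:E).
  by apply/measurable_EFinP; exact: measurableT_comp.
have mconv : measurable_fun setT
    (convolution (D 0) K : measurableTypeR R -> measurableTypeR R).
  pose KD (z : measurableTypeR R * measurableTypeR R) : \bar R :=
    (K z.2 * D 0 (z.1 - z.2))%:E.
  have mKD : measurable_fun setT KD.
    apply/measurable_EFinP; apply: measurable_funM; first exact: measurableT_comp.
    apply: (measurableT_comp (D_measurable (leq0n s))).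
    exact: measurable_funB.
  have mKDpos : measurable_fun setT (fun x => \int[mu]_y KD^\+ (x, y))%E.
    exact: (measurable_fun_fubini_tonelli_F _ (measurable_funepos mKD)
      (funepos_ge0 KD)).
  have mKDneg : measurable_fun setT (fun x => \int[mu]_y KD^\- (x, y))%E.
    exact: (measurable_fun_fubini_tonelli_F _ (measurable_funeneg mKD)
      (funeneg_ge0 KD)).
  have -> : convolution (D 0) K =
      fine \o (fun x => \int[mu]_y KD^\+ (x, y) - \int[mu]_y KD^\- (x, y))%E.
    apply/funext => x; rewrite /convolution /Rintegral integralE.
    congr (fine (_ - _)%E); apply: eq_integral => y _.
      by rewrite !funeposE.
    by rewrite !funenegE.
  apply: (measurableT_comp (fine_measurable measurableT)).
  exact: emeasurable_funB.
rewrite /norm1 -ge0_integralZl//.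
apply: (@le_trans _ _ (\int[mu]_x ((`|alpha s K| / s`!%:R)%:E * `|D s x|%:E +
    \int[mu]_u `|weighted_rem (x, u)|%:E))%E); last first.
  rewrite ge0_integralD//.
  - by rewrite leeD2l// integral_weighted_rem.
  - exact: measurable_funeM.
  - by move=> x _; exact: integral_ge0.
apply: ae_ge0_le_integral => //.
- apply/measurable_EFinP; apply: measurableT_comp => //.
  by apply: measurable_funB => //; exact: D_measurable.
- move=> x _; apply: adde_ge0; last exact: integral_ge0.
  by rewrite mule_ge0// lee_fin divr_ge0.
- by apply: emeasurable_funD => //; exact: measurable_funeM.
apply: filterS weighted_rem_integrable.
move=> x intT _; rewrite convolution_taylor//.
rewrite addrC (le_trans (y := (`|(-1) ^+ s / s`!%:R * alpha s K * D s x| +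
  `|\int[mu]_u weighted_rem (x, u)|)%:E))//.
  by rewrite lee_fin ler_normD.
rewrite EFinD leeD//.
  rewrite -EFinM lee_fin !normrM normrX normrN1 expr1n mul1r normfV.
  by rewrite (ger0_norm (ler0n _ _)) (mulrC (_^-1)).
rewrite -abse_EFin fineK; last exact: integrable_fin_num intT.
by apply: le_abse_integral => //; have /integrableP[] := intT.
Qed.

End convolution_error.

(** * Dilated kernels *)

Section dilation.
Set Implicit Arguments.
Unset Strict Implicit.
Context {R : realType}.
Notation mu := (@lebesgue_measure R).
Variables (h : R) (K : R -> R).
Hypothesis h_gt0 : 0 < h.

Let hV0 : h^-1 != 0. Proof. by rewrite invr_eq0 gt_eqF. Qed.

Let normhV : `|h^-1|^-1 = h.
Proof. by rewrite gtr0_norm ?invr_gt0// invrK. Qed.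

(* The form [h^-1 * t + 0] is the one of the affine changes of variables. *)
Let dilateE j : (fun t => t ^+ j * dilate h K t) =
  (fun t => (h^-1 * h ^+ j) * ((h^-1 * t + 0) ^+ j * K (h^-1 * t + 0))).
Proof.
apply/funext => t; rewrite /dilate addr0 (mulrC t) exprMn exprVn.
by field; rewrite expf_neq0 gt_eqF.
Qed.

Lemma dilate_moment j : L1 (fun t => t ^+ j * K t) ->
  L1 (fun t => t ^+ j * dilate h K t) /\
  alpha j (dilate h K) = h ^+ j * alpha j K.
Proof.
move=> K1; rewrite /alpha dilateE.
have Kaff := integrable_affine 0 hV0 K1.
split; first exact: (integrableZl measurableT (h^-1 * h ^+ j) Kaff).
rewrite RintegralZl// (Rintegral_affine 0 hV0 K1) normhV.
by field; rewrite gt_eqF.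
Qed.

Lemma dilate_kernel : is_kernel K -> is_kernel (dilate h K).
Proof.
have e0 G : (fun t : R => t ^+ 0 * G t) = G.
  by apply/funext => t; rewrite expr0 mul1r.
move=> [K1 KE]; have := @dilate_moment 0; rewrite /alpha !e0 => /(_ K1)[dK1 dKE].
by split=> //; rewrite dKE expr0 mul1r.
Qed.

Lemma dilate_beta m : L1 K ->
  (beta m (dilate h K) = (h `^ m)%:E * beta m K)%E.
Proof.
move=> /integrableP[/measurable_EFinP mK _].
have mb : measurable_fun setT (fun t : R => (`|t| `^ m * `|K t|)%:E).
  apply/measurable_EFinP; apply: measurable_funM; last exact: measurableT_comp.
  exact: (measurableT_comp (measurable_powR _)).
have b0 (t : R) : (0 <= (`|t| `^ m * `|K t|)%:E)%E.
  by rewrite lee_fin mulr_ge0// powR_ge0.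
have maff : measurable_fun setT
    (fun t : R => (`|h^-1 * t + 0| `^ m * `|K (h^-1 * t + 0)|)%:E).
  apply: (measurableT_comp mb (g := fun t : R => h^-1 * t + 0)).
  by apply: measurable_funD => //; exact: measurable_funM.
have hm : 0 <= h^-1 * h `^ m by rewrite mulr_ge0 ?powR_ge0// invr_ge0 ltW.
have hV_gt0 : 0 < h^-1 by rewrite invr_gt0.
have -> : beta m (dilate h K) = (\int[mu]_t ((h^-1 * h `^ m)%:E *
    (`|h^-1 * t + 0| `^ m * `|K (h^-1 * t + 0)|)%:E))%E.
  apply: eq_integral => t _; rewrite -EFinM; congr EFin.
  rewrite /dilate addr0 normrM (mulrC t) normrM (gtr0_norm hV_gt0).
  rewrite powRM// ?ltW//.
  have hh : h `^ m * h^-1 `^ m = 1.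
    by rewrite -powRM ?ltW// divff ?gt_eqF// powR1.
  by rewrite -[LHS]mulr1 -hh; ring.
rewrite ge0_integralZl//.
  rewrite [X in (_ * X)%E](@ge0_integral_affine _ _ 0 hV0
    (fun t => (`|t| `^ m * `|K t|)%:E) mb b0).
  rewrite normhV muleA -EFinM mulrC mulrA mulfV ?gt_eqF// mul1r.
  by [].
Qed.

End dilation.

(** * Iterated derivatives *)

Section derivatives.
Set Implicit Arguments.
Unset Strict Implicit.
Context {R : realType}.
Implicit Types f : R -> R.

Lemma abs_continuous_continuous f : abs_continuous f -> continuous f.
Proof.
move=> acf x; apply/cvgrPdist_lt => /= e e0.
have [d d0 Hd] := ac_along_continuous
  (abs_continuous_on_along (acf (x - 1) (x + 1))) e0.
near=> y.
have /ltr_normlP[xy1 xy2] : `|x - y| < Num.min d 1.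
  by near: y; apply: cvgr_dist_lt; rewrite // lt_min d0/=.
move: xy1 xy2; rewrite !lt_min => /andP[xy1 xy2] /andP[xy3 xy4].
have [yx|/ltW xy] := leP y x.
  by apply: Hd => //; lra.
by rewrite distrC; apply: Hd => //; lra.
Unshelve. all: by end_near. Qed.

Variables (f : R -> R) (s : nat).
Hypothesis s_gt0 : (0 < s)%N.
Hypothesis f_ac : abs_continuous_deriv s f.
Hypothesis f_L1 : L1 (derive1n s f).

Let derive1n_continuous k : (k < s)%N -> continuous (derive1n k f).
Proof.
rewrite -{1}(prednK s_gt0) ltnS leq_eqVlt => /predU1P[->|ks].
  exact: (abs_continuous_continuous f_ac.2).
by move=> x; exact/differentiable_continuous/derivable1_diffP/(f_ac.1 _ ks).
Qed.

Lemma derive1n_measurable k : (k <= s)%N -> measurable_fun setT (derive1n k f).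
Proof.
rewrite leq_eqVlt => /predU1P[->|ks].
  by have /integrableP[/measurable_EFinP] := f_L1.
by apply: continuous_measurable_fun; exact: derive1n_continuous.
Qed.

Lemma derive1n_primitive k : (k < s)%N ->
  is_primitive (derive1n k f) (derive1n k.+1 f).
Proof.
move=> ks; rewrite derive1nS.
have [ks'|] := ltnP k s.-1.
  apply: C1_primitive; first exact: (f_ac.1 _ ks').
  rewrite -derive1nS; apply: derive1n_continuous.
  by rewrite -(prednK s_gt0) ltnS.
move=> sk; have -> : k = s.-1.
  by apply/eqP; rewrite eqn_leq sk andbT -ltnS prednK.
apply: (abs_continuous_primitive f_ac.2).
by rewrite -derive1nS prednK.
Qed.

End derivatives.

(** * The rate of convergence *)

Theorem theorem2 (R : realType) (s : nat) (a : R) (h : nat -> R)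
    (K : nat -> R -> R) (f : R -> R) (c : R)
    (s_ge1 : (1 <= s)%N)
    (a_gt0 : 0 < a) (a_le1 : a <= 1)
    (h_gt0 : forall n, 0 < h n)
    (h_cvg0 : h n @[n --> \oo] --> (0 : R))
    (K_order : forall n, kernel_of_order s (K n))
    (K_alpha : (fun n => alpha s (K n)) =O_\oo (fun n => h n `^ a))
    (K_beta : (ereal_sup (range (fun n => beta (s%:R + a) (K n))) < +oo)%E)
    (f_density : is_density f)
    (f_ac : abs_continuous_deriv s f)
    (f_L1 : L1 (derive1n s f))
    (c_gt0 : 0 < c)
    (f_modulus : forall delta : R, 0 < delta ->
       (L1_modulus (derive1n s f) delta <= (c * `|delta| `^ a)%:E)%E) :
  let err := fun n => norm1 (fun x => convolution f (dilate (h n) (K n)) x - f x) in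
  (\forall n \near \oo, (err n < +oo)%E) /\
  (fun n => fine (err n)) =O_\oo (fun n => h n `^ (s%:R + a)).
Proof.
move=> err; pose D k := derive1n k f.
have c_ge0 := ltW c_gt0.
have D_modulus t :
    (\int[lebesgue_measure]_x `|D s (x + t) - D s x|%:E <=
     (c * `|t| `^ a)%:E)%E.
  have [->|t0] := eqVneq t 0.
    under eq_integral do rewrite addr0 subrr normr0.
    by rewrite integral0 lee_fin mulr_ge0// powR_ge0.
  have := f_modulus `|t|; rewrite normr_gt0 normr_id => /(_ t0).
  apply: le_trans; apply: ereal_sup_ubound; exists (- t) => /=.
    by rewrite normrN.
  by congr norm1; apply/funext => x; rewrite opprK.
pose B := ereal_sup (range (fun n => beta (s%:R + a) (K n))).
have betaB n : (beta (s%:R + a) (K n) <= B)%E.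
  by apply: ereal_sup_ubound; exists n.
have beta_ge0 n : (0 <= beta (s%:R + a) (K n))%E.
  by apply: integral_ge0 => t _; rewrite lee_fin mulr_ge0// powR_ge0.
have B_fin : B \is a fin_num.
  by rewrite ge0_fin_numE//; exact: le_trans (betaB 0%N).
pose G := norm1 (D s).
have G_fin : G \is a fin_num.
  rewrite ge0_fin_numE; last exact: integral_ge0.
  by have /integrableP[] := f_L1.
have err_le n : (err n <= ((h n ^+ s * `|alpha s (K n)| / s`!%:R) * fine G +
    c * (h n `^ (s%:R + a) * fine B))%:E)%E.
  have [[K1 KE] Kmom Kal _] := K_order n.
  have bfin : (beta (s%:R + a) (K n) < +oo)%E by exact: le_lt_trans (betaB n) _.
  have := @norm1_convolution_sub R D s s_ge1
    (derive1n_primitive s_ge1 f_ac f_L1) (derive1n_measurable s_ge1 f_ac f_L1)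
    a c a_gt0 c_ge0 D_modulus (dilate (h n) (K n))
    (dilate_kernel (h_gt0 n) (conj K1 KE)).
  rewrite dilate_beta//.
  have [|_ ->] := @dilate_moment R (h n) (K n) (h_gt0 n) s.
    by apply: Kmom; rewrite s_ge1 leqnn.
  move=> H; apply: le_trans (H _ _ _) _.
  - by move=> j /Kmom /(dilate_moment (h_gt0 n))[].
  - move=> j js; have [|_ ->] := @dilate_moment R (h n) (K n) (h_gt0 n) j.
      by apply: Kmom; case/andP: js => -> /ltnW.
    by rewrite Kal// mulr0.
  - by rewrite lte_mul_pinfty// lee_fin powR_ge0.
  rewrite EFinD leeD//.
    by rewrite [leRHS]EFinM fineK// normrM normrX (gtr0_norm (h_gt0 n)).
  rewrite !EFinM fineK// lee_wpmul2l// ?lee_fin//.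
  by rewrite lee_wpmul2l// lee_fin powR_ge0.
have G0 : 0 <= fine G by rewrite fine_ge0// integral_ge0.
have B0 : 0 <= fine B by rewrite fine_ge0//; exact: le_trans (betaB 0%N).
have err_ge0 n : (0 <= err n)%E by exact: integral_ge0.
have err_lty n : (err n < +oo)%E by exact: le_lt_trans (err_le n) (ltry _).
split; first exact: nearW.
have /eqO_exP[M M0 alphaM] := K_alpha.
(* The summand 1 makes the constant positive. *)
apply/eqO_exP; exists (M * fine G + c * fine B + 1).
  by rewrite ltr_wpDl// addr_ge0// mulr_ge0// ltW.
near=> n.
have hsa : h n `^ (s%:R + a) = h n ^+ s * h n `^ a.
  rewrite powRD; last by rewrite (gt_eqF (h_gt0 n)) implybT.
  by rewrite powR_mulrn// ltW.
have alphan : `|alpha s (K n)| <= M * h n `^ a.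
  by rewrite -(ger0_norm (powR_ge0 _ _)); near: n.
rewrite ger0_norm ?fine_ge0// (ger0_norm (powR_ge0 _ _)).
rewrite -lee_fin fineK ?ge0_fin_numE//; apply: le_trans (err_le n) _.
rewrite lee_fin hsa.
have ha0 : 0 <= h n `^ a by exact: powR_ge0.
have hs0 : 0 <= h n ^+ s by rewrite exprn_ge0// ltW.
have alpha_fact : `|alpha s (K n)| / s`!%:R <= M * h n `^ a.
  apply: le_trans alphan; rewrite ler_pdivrMr ?ltr0n ?fact_gt0//.
  by rewrite ler_peMr// ler1n fact_gt0.
apply: (@le_trans _ _ (h n ^+ s * (M * h n `^ a) * fine G +
    c * (h n ^+ s * h n `^ a * fine B))).
  by rewrite lerD2r ler_wpM2r// -mulrA ler_wpM2l.
have := mulr_ge0 hs0 ha0; lra.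
Unshelve. all: by end_near. Qed.
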